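(* Let $(A,\mu,\alpha)$ be a Hom-associative algebra, $(C,\Delta,\alpha)$ be a Hom-coassociative coalgebra, and $(H,\mu,\Delta,\alpha)$ be a Hom-bialgebra (all over $\mathbf{k}$). Then for each integer $n \geq 0$: (1) $A^n = (A,\ \mu^{(n)} = \alpha^{2^n-1}\circ \mu,\ \alpha^{2^n})$ is a Hom-associative algebra. (2) $C^n = (C,\ \Delta^{(n)} = \Delta \circ \alpha^{2^n-1},\ \alpha^{2^n})$ is a Hom-coassociative coalgebra. (3) $H^n = (H,\mu^{(n)},\Delta^{(n)},\alpha^{2^n})$ is a Hom-bialgebra, where $\mu^{(n)} = \alpha^{2^n-1}\circ \mu$ and $\Delta^{(n)} = \Delta \circ \alpha^{2^n-1}$.
   Context: $\mathbf{k}$ is a fixed associative and commutative ring of characteristic $0$; modules, tensor products and linear maps are over $\mathbf{k}$. For a self-map $\alpha$, $\alpha^n$ is the $n$-fold composition, $\alpha^0 = Id$. $\tau$ denotes the twist isomorphism $\tau(v\otimes w)=w\otimes v$. A Hom-associative algebra $(A,\mu,\alpha)$ is a $\mathbf{k}$-module $A$ with linear maps $\mu\colon A^{\otimes 2}\to A$ and $\alpha\colon A\to A$ such that $\alpha\circ\mu=\mu\circ\alpha^{\otimes 2}$ (multiplicativity) and $\mu\circ(\alpha\otimes\mu)=\mu\circ(\mu\otimes\alpha)$ (Hom-associativity). A Hom-coassociative coalgebra $(C,\Delta,\alpha)$ is a $\mathbf{k}$-module $C$ with linear maps $\Delta\colon C\to C^{\otimes 2}$ and $\alpha\colon C\to C$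 such that $\alpha^{\otimes 2}\circ\Delta=\Delta\circ\alpha$ (comultiplicativity) and $(\alpha\otimes\Delta)\circ\Delta=(\Delta\otimes\alpha)\circ\Delta$ (Hom-coassociativity). A Hom-bialgebra $(H,\mu,\Delta,\alpha)$ is such that $(H,\mu,\alpha)$ is a Hom-associative algebra, $(H,\Delta,\alpha)$ is a Hom-coassociative coalgebra, and $\Delta\circ\mu=\mu^{\otimes 2}\circ(Id\otimes\tau\otimes Id)\circ\Delta^{\otimes 2}$. No units or counits are required. *)

(* Defs.v *)
From HB Require Import structures.
From mathcomp Require Import all_boot all_algebra.
From mathcomp Require Import boolp.
From mathcomp.multinomials Require Import freeg.

Set Implicit Arguments.
Unset Strict Implicit.
Unset Printing Implicit Defensive.

Import GRing.Theory.
Local Open Scope ring_scope.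
Local Open Scope quotient_scope.

Reserved Notation "U \ox V" (at level 40, left associativity).
Reserved Notation "u \ot v" (at level 40, left associativity).

Section Tensor.
Variables (k : comNzRingType) (U V : lmodType k).

Local Notation free := {freeg (U * V) / k}.

(* The submodule of the free module on U * V generated by the relators which
   make (u, v) |-> << (u, v) >> bilinear modulo it. *)
Inductive tensor_rel : free -> Prop :=
| TensorRel0 : tensor_rel 0
| TensorRelP c x y : tensor_rel x -> tensor_rel y -> tensor_rel (c *: x + y)
| TensorRelDl u u' v :
    tensor_rel (<< (u + u', v) >> - << (u, v) >> - << (u', v) >>)
| TensorRelDr u v v' :
    tensor_rel (<< (u, v + v') >> - << (u, v) >> - << (u, v') >>)
| TensorRelZl c u v : tensor_rel (<< (c *: u, v) >> - c *: << (u, v) >>)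
| TensorRelZr c u v : tensor_rel (<< (u, c *: v) >> - c *: << (u, v) >>).

Definition tensor_relb : {pred free} := fun x => `[< tensor_rel x >].

Lemma tensor_relbP x : reflect (tensor_rel x) (x \in tensor_relb).
Proof. exact: asboolP. Qed.

Lemma tensor_relZ c x : tensor_rel x -> tensor_rel (c *: x).
Proof. by move=> hx; rewrite -[_ *: _]addr0; apply: TensorRelP => //; exact: TensorRel0. Qed.

Lemma tensor_relb_zmod_closed : zmod_closed tensor_relb.
Proof.
split=> [|x y /tensor_relbP hx /tensor_relbP hy].
  exact/tensor_relbP/TensorRel0.
by apply/tensor_relbP; rewrite addrC -scaleN1r; apply: TensorRelP.
Qed.

HB.instance Definition _ :=
  GRing.isZmodClosed.Build free tensor_relb tensor_relb_zmod_closed.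

Definition tensor_quot := @Quotient.quot free tensor_relb.

HB.instance Definition _ := GRing.Zmodule.on tensor_quot.

Definition tensor_pi (x : free) : tensor_quot := \pi_(@Quotient.quot free tensor_relb) x.

Lemma tensor_pi_eqP x y :
  reflect (tensor_rel (x - y)) (tensor_pi x == tensor_pi y).
Proof. by rewrite /tensor_pi -Quotient.idealrBE; apply: tensor_relbP. Qed.

Lemma tensor_pi_repr (t : tensor_quot) : tensor_pi (repr t) = t.
Proof. exact: reprK. Qed.

Lemma tensor_piD x y : tensor_pi (x + y) = tensor_pi x + tensor_pi y.
Proof. exact: (raddfD \pi_(@Quotient.quot free tensor_relb)). Qed.

Definition tensor_scale c (t : tensor_quot) : tensor_quot := tensor_pi (c *: repr t).

Lemma tensor_piZ c x : tensor_pi (c *: x) = tensor_scale c (tensor_pi x).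
Proof.
apply/eqP/tensor_pi_eqP; rewrite -scalerBr; apply: tensor_relZ.
by apply/tensor_pi_eqP; rewrite tensor_pi_repr.
Qed.

Lemma tensor_scaleA c d t :
  tensor_scale c (tensor_scale d t) = tensor_scale (c * d) t.
Proof. by rewrite -[t]tensor_pi_repr -!tensor_piZ scalerA. Qed.

Lemma tensor_scale1 : left_id 1 tensor_scale.
Proof. by move=> t; rewrite -[t]tensor_pi_repr -!tensor_piZ scale1r. Qed.

Lemma tensor_scaleDr : right_distributive tensor_scale +%R.
Proof.
move=> c t t'; rewrite -[t]tensor_pi_repr -[t']tensor_pi_repr.
by rewrite -tensor_piD -!tensor_piZ -tensor_piD scalerDr.
Qed.

Lemma tensor_scaleDl t : {morph tensor_scale^~ t : c d / c + d}.
Proof.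
move=> c d; rewrite -[t]tensor_pi_repr.
by rewrite -!tensor_piZ -tensor_piD scalerDl.
Qed.

HB.instance Definition _ := GRing.Zmodule_isLmodule.Build k tensor_quot
  tensor_scaleA tensor_scale1 tensor_scaleDr tensor_scaleDl.

Definition tensor : lmodType k := GRing.Lmodule.clone k tensor_quot _.

Lemma tensor_pi_is_linear : linear tensor_pi.
Proof. by move=> c x y; rewrite tensor_piD tensor_piZ. Qed.

HB.instance Definition _ :=
  GRing.isLinear.Build k free tensor *:%R tensor_pi tensor_pi_is_linear.

Definition tens (u : U) (v : V) : tensor := tensor_pi << (u, v) >>.

Lemma tensDl v : {morph tens^~ v : u u' / u + u'}.
Proof.
move=> u u'; rewrite /tens -tensor_piD; apply/eqP/tensor_pi_eqP.
by rewrite opprD addrA; apply: TensorRelDl.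
Qed.

Lemma tensDr u : {morph tens u : v v' / v + v'}.
Proof.
move=> v v'; rewrite /tens -tensor_piD; apply/eqP/tensor_pi_eqP.
by rewrite opprD addrA; apply: TensorRelDr.
Qed.

Lemma tensZl v : scalable (tens^~ v).
Proof.
move=> c u; rewrite /tens -linearZ; apply/eqP/tensor_pi_eqP.
exact: TensorRelZl.
Qed.

Lemma tensZr u : scalable (tens u).
Proof.
move=> c v; rewrite /tens -linearZ; apply/eqP/tensor_pi_eqP.
exact: TensorRelZr.
Qed.

Lemma tens_is_bilinear :
  (forall v, linear (tens^~ v)) * (forall u, linear (tens u)).
Proof.
split=> [v|u] c x y /=; first by rewrite tensDl tensZl.
by rewrite tensDr tensZr.
Qed.

HB.instance Definition _ :=
  bilinear_isBilinear.Build k U V tensor *:%R *:%R tens tens_is_bilinear.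

Lemma free_ind (P : free -> Prop) :
    (forall c x y, P x -> P y -> P (c *: x + y)) -> P 0 ->
    (forall u v, P << (u, v) >>) ->
  forall x, P x.
Proof.
move=> PD P0 P1; elim/freeg_ind_dom0 => // c [u v] x _ _ Px.
have -> : << c *g (u, v) >> = c *: << (u, v) >> :> free.
  by apply/eqP/freeg_eqP => z; rewrite coeffZ !coeffU mul1r.
exact: PD.
Qed.

Lemma tensor_ind (P : tensor -> Prop) :
    (forall t t', P t -> P t' -> P (t + t')) -> (forall u v, P (tens u v)) ->
  forall t, P t.
Proof.
move=> PD P1 t; rewrite -[t]tensor_pi_repr.
suff [] : P (tensor_pi (repr t)) /\ forall c, P (c *: tensor_pi (repr t)) by [].
elim/free_ind: (repr t) => [c x y [_ Px] [Py Pcy]||u v].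
- rewrite linearP; split=> [|d]; first exact: (PD _ _ (Px c)).
  by rewrite scalerDr scalerA; apply: (PD _ _ (Px _)).
- have P0 : P 0 by have := P1 0 0; rewrite linear0l.
  by rewrite linear0; split=> [|c]; rewrite ?scaler0.
- by split=> [|c]; rewrite -[tensor_pi _]/(tens u v) -?linearZl_LR.
Qed.

Section Lift.
Variables (W : lmodType k) (f : {bilinear U -> V -> W}).

Definition free_lift (x : free) : W := fglift (fun p => f p.1 p.2) x.

Lemma free_liftB : {morph free_lift : x y / x - y}.
Proof. exact: lift_is_additive. Qed.

HB.instance Definition _ :=
  GRing.isZmodMorphism.Build free W free_lift free_liftB.

Lemma free_liftZ : scalable free_lift.
Proof.
move=> c x; rewrite -[in RHS](freeg_sumE x) [c *: x]/(fgscale c x) /fgscale.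
rewrite !raddf_sum; apply: eq_bigr => p _.
by rewrite /= /free_lift !liftU scalerA.
Qed.

HB.instance Definition _ :=
  GRing.isScalable.Build k free W *:%R free_lift free_liftZ.

Lemma free_lift1 u v : free_lift << (u, v) >> = f u v.
Proof. by rewrite /free_lift liftU scale1r. Qed.

Lemma free_lift_rel x : tensor_rel x -> free_lift x = 0.
Proof.
elim=> [|c {}x y _ hx _ hy|u u' v|u v v'|c u v|c u v].
- exact: linear0.
- by rewrite linearP /= hx hy scaler0 addr0.
- by rewrite !linearB /= !free_lift1 linearDl addrAC addrK subrr.
- by rewrite !linearB /= !free_lift1 linearDr addrAC addrK subrr.
- by rewrite linearB linearZ /= !free_lift1 linearZl_LR subrr.
- by rewrite linearB linearZ /= !free_lift1 linearZr_LR subrr.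
Qed.

(* With tensor_liftE and tensor_ext, this is the universal property. *)
Definition tensor_lift (t : tensor) : W := free_lift (repr t).

Lemma tensor_lift_pi x : tensor_lift (tensor_pi x) = free_lift x.
Proof.
apply/eqP; rewrite -subr_eq0 -linearB; apply/eqP/free_lift_rel.
by apply/tensor_pi_eqP; rewrite tensor_pi_repr.
Qed.

Lemma tensor_lift_is_linear : linear tensor_lift.
Proof.
move=> c t t'; rewrite -[t]tensor_pi_repr -[t']tensor_pi_repr -linearP.
by rewrite !tensor_lift_pi linearP.
Qed.

HB.instance Definition _ :=
  GRing.isLinear.Build k tensor W *:%R tensor_lift tensor_lift_is_linear.

Lemma tensor_liftE u v : tensor_lift (tens u v) = f u v.
Proof. by rewrite tensor_lift_pi free_lift1. Qed.

End Lift.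

Lemma tensor_ext (W : lmodType k) (f g : {linear tensor -> W}) :
  (forall u v, f (tens u v) = g (tens u v)) -> f =1 g.
Proof.
by move=> fg; elim/tensor_ind => // t t' ft ft'; rewrite !linearD ft ft'.
Qed.

End Tensor.

Arguments tensor_rel {k U V} x.
Arguments tens {k U V} u v.
Arguments tensor {k} U V.
Arguments tensor_ext {k U V W f g}.

Notation "U \ox V" := (tensor U V) : type_scope.
Notation "u \ot v" := (tens u v) : ring_scope.

Section TensorMap.
Variables (k : comNzRingType) (U U' V V' : lmodType k).
Variables (f : {linear U -> U'}) (g : {linear V -> V'}).

Definition tens_comp (u : U) (v : V) : U' \ox V' := f u \ot g v.

Lemma tens_comp_is_bilinear :
  (forall v, linear (tens_comp^~ v)) * (forall u, linear (tens_comp u)).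
Proof.
by split=> [v|u] c x y; rewrite /tens_comp linearP (linearPl, linearPr).
Qed.

HB.instance Definition _ :=
  bilinear_isBilinear.Build k U V (U' \ox V') *:%R *:%R tens_comp
    tens_comp_is_bilinear.

Definition tensor_map : U \ox V -> U' \ox V' := tensor_lift tens_comp.

HB.instance Definition _ := GRing.Linear.on tensor_map.

Lemma tensor_mapE u v : tensor_map (u \ot v) = f u \ot g v.
Proof. exact: tensor_liftE. Qed.

End TensorMap.

Section Twist.
Variables (k : comNzRingType) (U V : lmodType k).

Definition tens_swap (u : U) (v : V) : V \ox U := v \ot u.

Lemma tens_swap_is_bilinear :
  (forall v, linear (tens_swap^~ v)) * (forall u, linear (tens_swap u)).
Proof. by split=> [v|u] c x y; rewrite /tens_swap (linearPl, linearPr). Qed.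

HB.instance Definition _ :=
  bilinear_isBilinear.Build k U V (V \ox U) *:%R *:%R tens_swap
    tens_swap_is_bilinear.

Definition twist : U \ox V -> V \ox U := tensor_lift tens_swap.

HB.instance Definition _ := GRing.Linear.on twist.

Lemma twistE u v : twist (u \ot v) = v \ot u.
Proof. exact: tensor_liftE. Qed.

End Twist.

Arguments twist {k U V} t.

Section Associator.
Variables (k : comNzRingType) (U V W : lmodType k).

Definition assoc_right (w : W) (u : U) (v : V) : U \ox (V \ox W) :=
  u \ot (v \ot w).

Lemma assoc_right_is_bilinear w :
  (forall y, linear ((assoc_right w)^~ y)) * (forall x, linear (assoc_right w x)).
Proof.
by split=> [v|u] c x y; rewrite /assoc_right ?linearPl ?linearPr.
Qed.

HB.instance Definition _ w :=
  bilinear_isBilinear.Build k U V (U \ox (V \ox W)) *:%R *:%R (assoc_right w)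
    (assoc_right_is_bilinear w).

Definition assoc_bil (t : U \ox V) (w : W) : U \ox (V \ox W) :=
  tensor_lift (assoc_right w) t.

Lemma assoc_bil_is_bilinear :
  (forall v, linear (assoc_bil^~ v)) * (forall u, linear (assoc_bil u)).
Proof.
split=> [w|t] c x y; rewrite /assoc_bil; first exact: linearP.
elim/tensor_ind: t => [t t' ht ht'|u v].
  by rewrite !(linearD (tensor_lift _)) /= ht ht' scalerDr addrACA.
by rewrite !tensor_liftE /= /assoc_right !linearPr.
Qed.

HB.instance Definition _ :=
  bilinear_isBilinear.Build k (U \ox V) W (U \ox (V \ox W)) *:%R *:%R assoc_bil
    assoc_bil_is_bilinear.

Definition tassoc : (U \ox V) \ox W -> U \ox (V \ox W) := tensor_lift assoc_bil.

HB.instance Definition _ := GRing.Linear.on tassoc.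

Lemma tassocE u v w : tassoc ((u \ot v) \ot w) = u \ot (v \ot w).
Proof. by rewrite /tassoc tensor_liftE /= /assoc_bil tensor_liftE. Qed.

Definition assoc_left (u : U) (v : V) (w : W) : (U \ox V) \ox W :=
  (u \ot v) \ot w.

Lemma assoc_left_is_bilinear u :
  (forall y, linear ((assoc_left u)^~ y)) * (forall x, linear (assoc_left u x)).
Proof.
by split=> [w|v] c x y; rewrite /assoc_left ?linearPr ?linearPl.
Qed.

HB.instance Definition _ u :=
  bilinear_isBilinear.Build k V W ((U \ox V) \ox W) *:%R *:%R (assoc_left u)
    (assoc_left_is_bilinear u).

Definition assocV_bil (u : U) (t : V \ox W) : (U \ox V) \ox W :=
  tensor_lift (assoc_left u) t.

Lemma assocV_bil_is_bilinear :
  (forall v, linear (assocV_bil^~ v)) * (forall u, linear (assocV_bil u)).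
Proof.
split=> [t|u] c x y; rewrite /assocV_bil; last exact: linearP.
elim/tensor_ind: t => [t t' ht ht'|v w].
  by rewrite !(linearD (tensor_lift _)) /= ht ht' scalerDr addrACA.
by rewrite !tensor_liftE /= /assoc_left !linearPl.
Qed.

HB.instance Definition _ :=
  bilinear_isBilinear.Build k U (V \ox W) ((U \ox V) \ox W) *:%R *:%R assocV_bil
    assocV_bil_is_bilinear.

Definition tassocV : U \ox (V \ox W) -> (U \ox V) \ox W :=
  tensor_lift assocV_bil.

HB.instance Definition _ := GRing.Linear.on tassocV.

Lemma tassocVE u v w : tassocV (u \ot (v \ot w)) = (u \ot v) \ot w.
Proof. by rewrite /tassocV tensor_liftE /= /assocV_bil tensor_liftE. Qed.

Lemma tassocK : cancel tassoc tassocV.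
Proof.
elim/tensor_ind => [t t' ht ht'|t w]; first by rewrite !linearD /= ht ht'.
elim/tensor_ind: t => [t t' ht ht'|u v].
  by rewrite linearDl !linearD /= ht ht'.
by rewrite tassocE tassocVE.
Qed.

Lemma tassocVK : cancel tassocV tassoc.
Proof.
elim/tensor_ind => [t t' ht ht'|u t]; first by rewrite !linearD /= ht ht'.
elim/tensor_ind: t => [t t' ht ht'|v w].
  by rewrite linearDr !linearD /= ht ht'.
by rewrite tassocVE tassocE.
Qed.

End Associator.

Arguments tassoc {k U V W} t.
Arguments tassocV {k U V W} t.

Section Interchange.
Variables (k : comNzRingType) (U V W X : lmodType k).

(* Id (x) twist (x) Id on the fourfold tensor product, conjugated by the
   associators so that domain and codomain are bracketed as pairs. *)
Definition tensor_interchange :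
    (U \ox V) \ox (W \ox X) -> (U \ox W) \ox (V \ox X) :=
  tassocV \o tensor_map idfun tassoc
  \o tensor_map idfun (tensor_map twist idfun)
  \o tensor_map idfun tassocV \o tassoc.

HB.instance Definition _ := GRing.Linear.on tensor_interchange.

Lemma tensor_interchangeE u v w x :
  tensor_interchange ((u \ot v) \ot (w \ot x)) = (u \ot w) \ot (v \ot x).
Proof.
rewrite /tensor_interchange /= tassocE !tensor_mapE /= tassocVE tensor_mapE /= twistE.
by rewrite tassocE tassocVE.
Qed.

End Interchange.

Arguments tensor_interchange {k U V W X} t.

Section Iter.
Variables (k : comNzRingType) (U : lmodType k) (n : nat) (f : {linear U -> U}).

Lemma iter_is_linear : linear (iter n f).
Proof. by move=> c x y; elim: n => //= m ->; rewrite linearP. Qed.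

HB.instance Definition _ :=
  GRing.isLinear.Build k U U *:%R (iter n f) iter_is_linear.

End Iter.

Section HomStructures.
Variable k : comNzRingType.

(* Triple tensor products are not strictly associative: tassoc identifies
   (A \ox A) \ox A with A \ox (A \ox A) in the two identities below. *)
Record hom_associative (A : lmodType k) (mu : {linear A \ox A -> A})
    (alpha : {linear A -> A}) : Prop := HomAssociative {
  hom_multiplicative : alpha \o mu =1 mu \o tensor_map alpha alpha;
  hom_assoc :
    mu \o tensor_map alpha mu \o tassoc =1 mu \o tensor_map mu alpha
}.

Record hom_coassociative (C : lmodType k) (Delta : {linear C -> C \ox C})
    (alpha : {linear C -> C}) : Prop := HomCoassociative {
  hom_comultiplicative : tensor_map alpha alpha \o Delta =1 Delta \o alpha;
  hom_coassoc :
    tensor_map alpha Delta \o Delta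
      =1 tassoc \o tensor_map Delta alpha \o Delta
}.

Record hom_bialgebra (H : lmodType k) (mu : {linear H \ox H -> H})
    (Delta : {linear H -> H \ox H}) (alpha : {linear H -> H}) : Prop :=
  HomBialgebra {
  hom_bialgebra_assoc : hom_associative mu alpha;
  hom_bialgebra_coassoc : hom_coassociative Delta alpha;
  hom_compat :
    Delta \o mu
      =1 tensor_map mu mu \o tensor_interchange \o tensor_map Delta Delta
}.

End HomStructures.

(* Main.v *)
Require Import Defs.
From mathcomp Require Import all_boot all_algebra.

Set Implicit Arguments.
Unset Strict Implicit.
Unset Printing Implicit Defensive.

Import GRing.Theory.
Local Open Scope ring_scope.

(** The theorem is an instance of a twisting principle. Let [beta] be an
    endomorphism of a Hom-structure, that is, a linear map commuting with
    [alpha] and with the operations. Replacing [mu] by [beta \o mu], [Delta] by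
    [Delta \o beta] and [alpha] by [beta \o alpha] inserts the same number of
    copies of [beta] on both sides of every axiom, and since [beta] slides
    through the operations all of these copies can be collected at one end,
    leaving the original axiom. This is [twist_hom_associative],
    [twist_hom_coassociative] and [twist_hom_bialgebra].

    (Co)multiplicativity says precisely that [alpha], hence each of its
    iterates, is such an endomorphism. Twisting by the [m]-th iterate turns
    [alpha] into its [m.+1]-st iterate, and the theorem is the case
    [m = 2 ^ n - 1]. *)

(** The composites enter as maps [f] and [g] with pointwise equations because
    [tensor_map] takes bundled linear maps: an iterate [iter m.+1 alpha] and a
    composite [iter m alpha \o alpha] are then distinct arguments, even though
    the underlying functions agree. *)
Lemma tensor_map_comp (k : comNzRingType) (U U' U'' V V' V'' : lmodType k)
    (f1 : {linear U' -> U''}) (f2 : {linear U -> U'}) (f : {linear U -> U''})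
    (g1 : {linear V' -> V''}) (g2 : {linear V -> V'}) (g : {linear V -> V''}) :
    f =1 f1 \o f2 -> g =1 g1 \o g2 ->
  tensor_map f g =1 tensor_map f1 g1 \o tensor_map f2 g2.
Proof.
move=> fE gE; apply: tensor_ext => u v.
by rewrite /= !tensor_mapE fE gE.
Qed.

Arguments tensor_map_comp {k U U' U'' V V' V''} f1 f2 f g1 g2 g _ _ _.

Lemma tensor_map_id (k : comNzRingType) (U V : lmodType k)
    (f : {linear U -> U}) (g : {linear V -> V}) :
  f =1 id -> g =1 id -> tensor_map f g =1 id.
Proof.
move=> fE gE; apply: (@tensor_ext _ _ _ _ _ idfun) => u v.
by rewrite /= tensor_mapE fE gE.
Qed.

Section Twisting.
Variables (k : comNzRingType) (A : lmodType k).
Variables (mu : {linear A \ox A -> A}) (Delta : {linear A -> A \ox A}).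
Variables alpha beta gamma : {linear A -> A}.
Hypothesis beta_alpha : beta \o alpha =1 alpha \o beta.
Hypothesis gammaE : gamma =1 beta \o alpha.

Let gammaEr : gamma =1 alpha \o beta.
Proof. by move=> x; rewrite gammaE beta_alpha. Qed.

(** Both sides of Hom-associativity reduce to [beta \o beta] after the
    corresponding side for [mu] and [alpha]. *)
Lemma twist_hom_associative :
    beta \o mu =1 mu \o tensor_map beta beta ->
    hom_associative mu alpha -> hom_associative (beta \o mu) gamma.
Proof.
move=> beta_mu [alpha_mu mu_assoc]; split=> t.
  rewrite /= (tensor_map_comp _ _ _ _ _ _ gammaEr gammaEr) /= gammaE /=.
  by rewrite [beta (mu t)]beta_mu [alpha _]alpha_mu.
rewrite /= (tensor_map_comp beta alpha _ beta mu _) //.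
rewrite (tensor_map_comp beta mu _ beta alpha _) //=.
by rewrite -![mu (tensor_map beta beta _)]beta_mu /= [mu _]mu_assoc.
Qed.

(** Dually, both sides of Hom-coassociativity reduce to the corresponding side
    for [Delta] and [alpha] precomposed with [beta \o beta]. *)
Lemma twist_hom_coassociative :
    tensor_map beta beta \o Delta =1 Delta \o beta ->
    hom_coassociative Delta alpha -> hom_coassociative (Delta \o beta) gamma.
Proof.
move=> beta_Delta [alpha_Delta Delta_coassoc]; split=> x.
  rewrite /= (tensor_map_comp _ _ _ _ _ _ gammaE gammaE) /=.
  by rewrite [tensor_map alpha _ _]alpha_Delta [LHS]beta_Delta /= gammaEr.
rewrite /= (tensor_map_comp alpha beta _ Delta beta _) //.
rewrite (tensor_map_comp Delta beta _ alpha beta _) //=.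
by rewrite ![tensor_map beta beta _]beta_Delta [LHS]Delta_coassoc.
Qed.

(** In the compatibility axiom the inner copies of [beta] pass through [mu] and
    the outer ones through [Delta]. *)
Lemma twist_hom_bialgebra :
    beta \o mu =1 mu \o tensor_map beta beta ->
    tensor_map beta beta \o Delta =1 Delta \o beta ->
    hom_bialgebra mu Delta alpha ->
  hom_bialgebra (beta \o mu) (Delta \o beta) gamma.
Proof.
move=> beta_mu beta_Delta [mu_assoc Delta_coassoc mu_Delta].
split; [exact: twist_hom_associative | exact: twist_hom_coassociative |].
move=> t /=.
rewrite (tensor_map_comp beta mu _ beta mu _) //.
rewrite (tensor_map_comp Delta beta _ Delta beta _) //=.
rewrite -[tensor_map mu mu _]mu_Delta /= -[mu (tensor_map _ _ _)]beta_mu.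
by rewrite [RHS]beta_Delta.
Qed.

End Twisting.

Section Iterates.
Variables (k : comNzRingType) (A : lmodType k).
Variables (mu : {linear A \ox A -> A}) (Delta : {linear A -> A \ox A}).
Variables (alpha : {linear A -> A}) (m : nat).

Lemma iter_multiplicative :
    alpha \o mu =1 mu \o tensor_map alpha alpha ->
  iter m alpha \o mu =1 mu \o tensor_map (iter m alpha) (iter m alpha).
Proof.
move=> alpha_mu t /=; elim: m => [|p IHp] /=.
  by rewrite tensor_map_id.
rewrite IHp [alpha _]alpha_mu /=.
by rewrite (tensor_map_comp alpha (iter p alpha) (iter p.+1 alpha)
                            alpha (iter p alpha) (iter p.+1 alpha)).
Qed.

Lemma iter_comultiplicative :
    tensor_map alpha alpha \o Delta =1 Delta \o alpha ->
  tensor_map (iter m alpha) (iter m alpha) \o Delta =1 Delta \o iter m alpha.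
Proof.
move=> alpha_Delta x /=; elim: m => [|p IHp] /=.
  by rewrite tensor_map_id.
rewrite (tensor_map_comp alpha (iter p alpha) (iter p.+1 alpha)
                            alpha (iter p alpha) (iter p.+1 alpha)) //=.
by rewrite IHp [LHS]alpha_Delta.
Qed.

Let iter_alphaC : iter m alpha \o alpha =1 alpha \o iter m alpha.
Proof. by move=> x; rewrite /= -iterSr. Qed.

Let iterS_comp : iter m.+1 alpha =1 iter m alpha \o alpha.
Proof. by move=> x; rewrite iterSr. Qed.

Lemma iter_hom_associative :
    hom_associative mu alpha ->
  hom_associative (iter m alpha \o mu) (iter m.+1 alpha).
Proof.
move=> mu_assoc; apply: twist_hom_associative (mu_assoc) => //.
exact/iter_multiplicative/(hom_multiplicative mu_assoc).
Qed.

Lemma iter_hom_coassociative :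
    hom_coassociative Delta alpha ->
  hom_coassociative (Delta \o iter m alpha) (iter m.+1 alpha).
Proof.
move=> Delta_coassoc; apply: twist_hom_coassociative (Delta_coassoc) => //.
exact/iter_comultiplicative/(hom_comultiplicative Delta_coassoc).
Qed.

Lemma iter_hom_bialgebra :
    hom_bialgebra mu Delta alpha ->
  hom_bialgebra (iter m alpha \o mu) (Delta \o iter m alpha)
    (iter m.+1 alpha).
Proof.
move=> bialg; have [mu_assoc Delta_coassoc _] := bialg.
apply: twist_hom_bialgebra bialg => //.
  exact/iter_multiplicative/(hom_multiplicative mu_assoc).
exact/iter_comultiplicative/(hom_comultiplicative Delta_coassoc).
Qed.

End Iterates.

(* [pchar k] =i pred0 would be too weak for a ring that is not a domain: it
   holds for Z/4. *)
Theorem theorem2p11 (k : comNzRingType)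
    (char0 : forall m : nat, (0 < m)%N -> m%:R != 0 :> k)
    (A : lmodType k) (muA : {linear A \ox A -> A}) (alphaA : {linear A -> A})
    (C : lmodType k) (DeltaC : {linear C -> C \ox C})
    (alphaC : {linear C -> C})
    (H : lmodType k) (muH : {linear H \ox H -> H})
    (DeltaH : {linear H -> H \ox H}) (alphaH : {linear H -> H})
    (hA : hom_associative muA alphaA)
    (hC : hom_coassociative DeltaC alphaC)
    (hH : hom_bialgebra muH DeltaH alphaH) (n : nat) :
  [/\ hom_associative (iter (2 ^ n - 1)%N alphaA \o muA)
        (iter (2 ^ n)%N alphaA),
      hom_coassociative (DeltaC \o iter (2 ^ n - 1)%N alphaC)
        (iter (2 ^ n)%N alphaC)
    & hom_bialgebra (iter (2 ^ n - 1)%N alphaH \o muH)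
        (DeltaH \o iter (2 ^ n - 1)%N alphaH) (iter (2 ^ n)%N alphaH)].
Proof.
have -> : (2 ^ n = (2 ^ n - 1).+1)%N by rewrite subn1 prednK ?expn_gt0.
rewrite [((_.+1) - 1)%N]subn1 /=.
split; [exact: iter_hom_associative | exact: iter_hom_coassociative |].
exact: iter_hom_bialgebra.
Qed.
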